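(* Let $G$ be a finite group. Then $LC(G)$ is a nilpotent characteristic subgroup of $G$.
   Context: $o(x)$ denotes the order of an element $x$. $LCM(G)$ is the set of all $x\in G$ such that $o(x^n z)$ divides $\mathrm{lcm}(o(x^n),o(z))$ for all $z\in G$ and all integers $n$. $LC(G)=\langle LCM(G)\rangle$ is the subgroup of $G$ generated by $LCM(G)$. *)

(* Defs.v *)
From mathcomp Require Import all_boot all_order all_algebra all_fingroup all_solvable.
From mathcomp Require Import boolp.

Set Implicit Arguments.
Unset Strict Implicit.
Unset Printing Implicit Defensive.

Local Open Scope group_scope.

(* The group library only has powers by naturals; note Negz k is - k.+1. *)
Definition expgz (gT : finGroupType) (x : gT) (n : int) : gT :=
  match n with
  | Posz k => x ^+ k
  | Negz k => x ^- k.+1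
  end.

(* The quantifier over int is not boolean, hence the classical `[< _ >]. *)
Definition LCM (gT : finGroupType) (G : {group gT}) : {set gT} :=
  [set x in G | `[< forall (z : gT) (n : int), z \in G ->
     #[expgz x n * z] %| lcmn #[expgz x n] #[z] >]].

Definition LC (gT : finGroupType) (G : {group gT}) : {group gT} :=
  <<LCM G>>%G.

(* Main.v *)
Require Import Defs.
From mathcomp Require Import all_boot all_order all_algebra all_fingroup all_solvable.
From mathcomp Require Import boolp.

(** If [x] is in [LCM G] and [p] is prime, the [p]-part [x.`_p] is a power of
    [x], so the divisibility condition makes [x.`_p * z] a [p]-element whenever
    [z] is one.  The elements that multiply [p]-elements to [p]-elements form a
    normal [p]-subgroup of [G] ([pelt_mulg_group], [pelt_mulg_sub_pcore]), hence
    [x.`_p] is in ['O_p(G)].  As [x] is the product of its [p]-parts, it lies in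
    the Fitting subgroup, and so [LC G] is a subgroup of a nilpotent group.

    [LC G] is characteristic because [LCM G] is defined from the group law and
    element orders, which automorphisms preserve. *)

Set Implicit Arguments.
Unset Strict Implicit.
Unset Printing Implicit Defensive.

Local Open Scope group_scope.

(** This set takes the place of the subgroup generated by the [p]-parts of
    [LCM G].  Being a stabiliser, it is visibly closed under products, which
    spares an induction on words in the generators. *)
Definition pelt_mulg_set (gT : finGroupType) (p : nat) (G : {set gT}) :=
  [set y in G | [forall z in G, p.-elt z ==> p.-elt (y * z)]].

Lemma pelt_mulgP (gT : finGroupType) (p : nat) (G : {group gT}) (y : gT) :
  reflect (y \in G /\ forall z, z \in G -> p.-elt z -> p.-elt (y * z))
          (y \in pelt_mulg_set p G).
Proof.
rewrite inE; apply: (iffP andP) => [] [Gy mul_y]; split=> //.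
  by move=> z Gz; apply/implyP; apply: (forall_inP mul_y).
by apply/forall_inP=> z Gz; apply/implyP; apply: mul_y.
Qed.

Lemma pelt_mulg_group (gT : finGroupType) (p : nat) (G : {group gT}) :
  group_set (pelt_mulg_set p G).
Proof.
apply/group_setP; split=> [|y1 y2 /pelt_mulgP[Gy1 mul1] /pelt_mulgP[Gy2 mul2]].
  by apply/pelt_mulgP; split=> // z Gz; rewrite mul1g.
apply/pelt_mulgP; split=> [|z Gz pz]; first exact: groupM.
by rewrite -mulgA mul1 ?groupM ?mul2.
Qed.

Canonical pelt_mulg (gT : finGroupType) (p : nat) (G : {group gT}) :=
  Group (pelt_mulg_group p G).

(** Multiplying by the [p]-element [z = 1] shows that only [p]-elements occur
    here, and the [p]-elements of [G] are permuted by conjugation, so the group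
    is normal. *)
Lemma pelt_mulg_sub_pcore (gT : finGroupType) (p : nat) (G : {group gT}) :
  pelt_mulg_set p G \subset 'O_p(G).
Proof.
apply: (@pcore_max _ _ _ (pelt_mulg p G)).
  apply/pgroupP=> q q_pr /Cauchy[] // y /pelt_mulgP[Gy mul_y] oy.
  have: p.-elt (y * 1) by apply: mul_y; rewrite ?group1 ?p_elt1.
  by rewrite mulg1 /p_elt oy pnatE.
apply/normalP; split=> [|g Gg]; first by apply/subsetP=> y /pelt_mulgP[].
apply/eqP; rewrite eqEcard cardJg leqnn andbT.
apply/subsetP=> _ /imsetP[y /pelt_mulgP[Gy mul_y] ->].
apply/pelt_mulgP; split=> [|z Gz pz]; first exact: groupJ.
(* (y ^ g) * z is the conjugate by g of y * (z ^ g^-1). *)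
rewrite -[z](conjgKV g) -conjMg p_eltJ.
by apply: mul_y; rewrite ?groupJ ?groupV ?p_eltJ.
Qed.

Lemma LCMP (gT : finGroupType) (G : {group gT}) (x : gT) :
  reflect (x \in G /\ forall z n, z \in G ->
             #[expgz x n * z] %| lcmn #[expgz x n] #[z])
          (x \in LCM G).
Proof.
by rewrite inE; apply: (iffP andP) => [] [Gx /asboolP lcm_x].
Qed.

(** The powers of [x] in the definition of [LCM] matter here: they let the
    divisibility condition be applied to [x.`_p], and the lcm of two powers of
    [p] is again a power of [p]. *)
Lemma LCM_constt_pcore (gT : finGroupType) (G : {group gT}) (x : gT) (p : nat) :
  x \in LCM G -> x.`_p \in 'O_p(G).
Proof.
case/LCMP=> Gx lcm_x; apply: (subsetP (pelt_mulg_sub_pcore p G)).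
apply/pelt_mulgP; split=> [|z Gz pz]; first exact: groupX.
have [k xpE]: exists k, x.`_p = expgz x (Posz k) by eexists.
have px: p.-elt x.`_p by apply: p_elt_constt.
have := lcm_x z (Posz k) Gz; rewrite -xpE => /pnat_dvd; apply.
have lcm_dvd: lcmn #[x.`_p] #[z] %| #[x.`_p] * #[z].
  by rewrite dvdn_lcm dvdn_mulr ?dvdn_mull.
by apply: (pnat_dvd lcm_dvd); rewrite pnatM; apply/andP.
Qed.

Lemma LCM_sub_Fitting (gT : finGroupType) (G : {group gT}) :
  LCM G \subset 'F(G).
Proof.
apply/subsetP=> x LCMx; rewrite -(prod_constt x).
apply: group_prod => p _; have := LCM_constt_pcore p LCMx.
by rewrite -p_core_Fitting; apply/subsetP/pcore_sub.
Qed.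

Lemma morph_expgz (gT rT : finGroupType) (G : {group gT})
    (f : {morphism G >-> rT}) (x : gT) (n : int) :
  x \in G -> f (expgz x n) = expgz (f x) n.
Proof.
by case: n => k Gx /=; rewrite ?morphV ?groupX // morphX.
Qed.

Lemma groupXz (gT : finGroupType) (G : {group gT}) (x : gT) (n : int) :
  x \in G -> expgz x n \in G.
Proof. by case: n => k Gx /=; rewrite ?groupV groupX. Qed.

(** For an automorphism [f] of [G], where [f @* G = G], this inclusion is all
    that characteristicity of [LC G] needs, [G] being finite. *)
Lemma injm_LCM (gT rT : finGroupType) (G : {group gT})
    (f : {morphism G >-> rT}) :
  'injm f -> f @* LCM G \subset LCM (f @* G).
Proof.
move=> injf; apply/subsetP=> _ /morphimP[x Gx /LCMP[_ lcm_x] ->].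
apply/LCMP; split=> [|_ n /morphimP[z Gz _ ->]]; first exact: mem_morphim.
have Gxn := groupXz n Gx.
by rewrite -morph_expgz // -morphM // !order_injm ?groupM ?lcm_x.
Qed.

Lemma LC_char (gT : finGroupType) (G : {group gT}) : LC G \char G.
Proof.
have sLG: LCM G \subset G by apply/subsetP=> x /LCMP[].
apply/charP; split=> [|f injf fG]; first by rewrite gen_subG.
apply/eqP; rewrite eqEcard card_injm ?gen_subG // leqnn andbT.
rewrite morphim_gen // genS //.
have fGG: (f @* G)%G = G by apply: val_inj.
by have := injm_LCM injf; rewrite fGG.
Qed.

Unset Implicit Arguments.

Theorem corollary2p9 (gT : finGroupType) (G : {group gT}) :
  nilpotent (LC G) /\ LC G \char G.
Proof.
split; last exact: LC_char.
by apply: nilpotentS (Fitting_nil G); rewrite gen_subG LCM_sub_Fitting.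
Qed.
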